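(* Let $Q$ be a process on $A^{\mathbb{Z}}$ and $\Theta\subseteq\mathcal{P}_{\mathrm{stat}}(A^{\mathbb{Z}})$. Assume that for each $P\in\Theta$ and $\gamma_P$-almost every $W$ the relative entropy rate $h(W,Q)$ exists and $\bar\beta_\varepsilon(W,Q)\le-h(W,Q)$ for all $\varepsilon\in(0,1)$. Then $\underline{h}(P,Q)\in[0,+\infty]$ exists for all $P\in\Theta$, and for every $\Omega\subseteq\Theta$ and every $\eta>0$ there are subsets $M_n\subseteq A^n$ with $\lim_nP^{(n)}(M_n)=1$ for all $P\in\Omega$, and $\limsup_n\frac1n\log Q^{(n)}(M_n)\le-\underline{h}(\Omega,Q)+\eta$ if $\underline{h}(\Omega,Q)<\infty$, resp. $\le -1/\eta$ if $\underline{h}(\Omega,Q)=\infty$. Moreover every sequence $\tilde M_n\subseteq A^n$ with $\lim_nP^{(n)}(\tilde M_n)=1$ for all $P\in\Omega$ satisfies $\liminf_n\frac1n\log Q^{(n)}(\tilde M_n)\ge-\underline{h}(\Omega,Q)$.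
   Context: $A$ finite set; processes are probability measures on $A^{\mathbb{Z}}$ (cylinder $\sigma$-field); $P^{(n)}$ is the marginal on coordinates $\{0,\dots,n-1\}$. $\mathcal{P}_{\mathrm{stat}}(A^{\mathbb{Z}})$ is the set of shift-invariant processes; each $P$ in it has an ergodic decomposition $P=\int W\,\gamma_P(dW)$ over ergodic processes $W$. $h(W,Q)=\lim_n\frac1nH(W^{(n)},Q^{(n)})$ (when it exists in $[0,\infty]$), $H$ the Kullback–Leibler divergence. $\beta_{\varepsilon,n}(W,Q)=\min\{\log Q^{(n)}(M):M\subseteq A^n,W^{(n)}(M)\ge1-\varepsilon\}$, $\bar\beta_\varepsilon=\limsup_n\frac1n\beta_{\varepsilon,n}$. $\underline{h}(P,Q):=\operatorname{ess\,inf}_{\gamma_P(dW)}h(W,Q)$ and $\underline{h}(\Omega,Q):=\inf_{P\in\Omega}\underline{h}(P,Q)$. *)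

(* Defs.v *)
From HB Require Import structures.
From mathcomp Require Import all_boot all_order all_algebra.
From mathcomp Require Import all_classical all_reals all_analysis.
From mathcomp Require Import ess_sup_inf.
Set Implicit Arguments. Unset Strict Implicit. Unset Printing Implicit Defensive.
Import Order.TTheory GRing.Theory Num.Theory numFieldNormedType.Exports.
Local Open Scope classical_set_scope.
Local Open Scope ring_scope.

(** A finite, nonempty alphabet (nonemptiness is needed for a pointed type;
    with A empty there is no process at all). *)
#[short(type="pfinType")]
HB.structure Definition PointedFinite := {T of Finite T & isPointed T}.

Section Processes.
Variables (R : realType) (A : pfinType).

Definition coord_sets : set (set (int -> A)) :=
  [set [set x : int -> A | x i = a] | i in [set: int] & a in [set: A]].

Local Notation seqZ := (g_sigma_algebraType coord_sets).

Local Notation process := (probability seqZ R).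

Definition shift (x : seqZ) : seqZ := fun i => x (i + 1).

Definition stationary (P : process) : Prop :=
  forall B : set seqZ, measurable B -> P (shift @^-1` B) = P B.

Definition ergodic (P : process) : Prop :=
  stationary P /\
  forall B : set seqZ, measurable B -> shift @^-1` B = B ->
    P B = 0%E \/ P B = 1%E.

(** The space of processes, with the sigma-field generated by W |-> W(B). *)
Local Notation procspace := (pprobability seqZ R).

Definition ergodic_decomposition (P : process) (gam : probability procspace R) : Prop :=
  {ae gam, forall W : procspace, ergodic W} /\
  forall B : set seqZ, measurable B -> P B = (\int[gam]_W (W : process) B)%E.

Definition cyl (n : nat) (M : {set n.-tuple A}) : set seqZ :=
  [set x : seqZ | [tuple x (Posz (nat_of_ord i)) | i < n] \in M].

Definition marg (P : process) (n : nat) (M : {set n.-tuple A}) : R :=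
  fine (P (cyl M)).

Definition elog (x : R) : \bar R := if x == 0 then -oo%E else (ln x)%:E.

Definition kl_term (p q : R) : \bar R :=
  if p == 0 then 0%E else if q == 0 then +oo%E else (p * ln (p / q))%:E.

Definition kl (W Q : process) (n : nat) : \bar R :=
  (\sum_(w : n.-tuple A) kl_term (marg W [set w]) (marg Q [set w]))%E.

Definition kl_seq (W Q : process) (n : nat) : \bar R :=
  (kl W Q n * (n%:R^-1)%:E)%E.

(** h(W,Q) exists (as a limit in [-oo,+oo], necessarily in [0,+oo]) *)
Definition has_rel_ent_rate (W Q : process) : Prop :=
  exists l : \bar R, kl_seq W Q @ \oo --> l.

Definition rel_ent_rate (W Q : process) : \bar R := limn (kl_seq W Q).

Definition beta (eps : R) (n : nat) (W Q : process) : \bar R :=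
  ereal_inf [set elog (marg Q M) |
             M in [set M : {set n.-tuple A} | 1 - eps <= marg W M]].

Definition betabar (eps : R) (W Q : process) : \bar R :=
  limn_esup (fun n => (beta eps n W Q * (n%:R^-1)%:E)%E).

Definition hlow (gam : process -> probability procspace R) (P Q : process) : \bar R :=
  ess_inf (gam P) (fun W : procspace => rel_ent_rate W Q).

Definition hlowset (gam : process -> probability procspace R) (Om : set process)
  (Q : process) : \bar R :=
  ereal_inf [set hlow gam P Q | P in Om].

Definition lograte (Q : process) (M : forall n, {set n.-tuple A}) (n : nat) : \bar R :=
  (elog (marg Q (M n)) * (n%:R^-1)%:E)%E.

End Processes.
Notation seqZ A := (g_sigma_algebraType (@coord_sets A)).
Notation process R A := (probability (seqZ A) R).
Notation procspace R A := (pprobability (seqZ A) R).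

(* Main.v *)
Require Import Defs.
From HB Require Import structures.
From mathcomp Require Import all_boot all_order all_algebra.
From mathcomp Require Import all_classical all_reals all_analysis.
From mathcomp Require Import measurable_realfun ess_sup_inf.
From mathcomp Require Import ring lra zify.
Import Order.TTheory GRing.Theory Num.Theory numFieldNormedType.Exports.
Local Open Scope classical_set_scope.
Local Open Scope ring_scope.

(** Since Omega may be uncountable, the tests must not depend on the source.
    A countable mixture mu of block-i.i.d. laws with rational block weights is
    universal: for every stationary W the normalised divergence of W^(n) from
    mu is o(1), because H(W^(n))/n is at least inf_k H(W^(k))/k and some block
    law comes arbitrarily close to this infimum.  Hence W(x) <= e^(nd) mu(x)
    with W-probability tending to 1, for every d > 0.  The test
    M_n = { x : Q(x) <= e^(-nc) mu(x) } has Q(M_n) <= e^(-nc), and it is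
    typical for every stationary W with c < h(W,Q): on the near-optimal sets
    provided by the bound on beta, Q is exponentially small and therefore is
    W-mostly dominated by e^(-nc) mu.  Dominated convergence over the ergodic
    decomposition transfers this to P.

    Conversely, Young's inequality bounds H(W^(n),Q^(n)) below by
    a W(M) + Q(M) - e^a Q(M) for every a.  If Q(M_n) < e^(-nc) infinitely often
    while P(M_n) -> 1, Fatou's lemma gives, for almost every W, such n with
    W(M_n) close to 1, and a = nc yields h(W,Q) >= c. *)

(** * Marginals of processes *)

Section Marginals.
Context {R : realType} {A : pfinType}.
Implicit Types (P W Q : process R A) (k n : nat).

(** The window starts at [k]: one shift moves it by one place, so stationarity reaches every window
    by induction on [k]. *)
Definition shifted_cyl k n (M : {set n.-tuple A}) : set (seqZ A) :=
  [set x : seqZ A | [tuple x (Posz (k + i)) | i < n] \in M].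

Lemma cylE n (M : {set n.-tuple A}) : cyl M = shifted_cyl 0 n M.
Proof. by []. Qed.

Lemma measurable_coord (i : int) (a : A) :
  measurable ([set x | x i = a] : set (seqZ A)).
Proof. by apply: sub_gen_smallest; exists i => //; exists a. Qed.

Lemma measurable_shifted_cyl k n (M : {set n.-tuple A}) :
  measurable (shifted_cyl k n M).
Proof.
rewrite (_ : shifted_cyl k n M = \bigcup_(w in [set` M])
    \bigcap_(i in [set: 'I_n]) [set x | x (Posz (k + i)) = tnth w i]); last first.
  apply/seteqP; split => x /=.
    by move=> xM; exists [tuple x (Posz (k + i)) | i < n] => //= i _ /=;
      rewrite tnth_mktuple.
  move=> [w wM xw]; rewrite /shifted_cyl /=.
  suff -> : [tuple x (Posz (k + i)) | i < n] = w by [].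
  by apply: eq_from_tnth => i; rewrite tnth_mktuple; exact: (xw i).
apply: fin_bigcup_measurable => // w _.
by apply: fin_bigcap_measurable => // i _; exact: measurable_coord.
Qed.

Lemma measurable_cyl n (M : {set n.-tuple A}) : measurable (cyl M).
Proof. by rewrite cylE; exact: measurable_shifted_cyl. Qed.

Lemma stationary_shifted_cyl P k n (M : {set n.-tuple A}) :
  stationary P -> P (shifted_cyl k n M) = P (cyl M).
Proof.
move=> sP; elim: k => [|k IH]; first by rewrite cylE.
rewrite -IH -(sP _ (measurable_shifted_cyl k n M)); congr (P _).
apply/seteqP; split => x /=; rewrite /shifted_cyl /shift /=;
  congr (_ \in M); apply: eq_from_tnth => i; rewrite !tnth_mktuple;
  by congr (x _); lia.
Qed.

Lemma EFin_marg P n (M : {set n.-tuple A}) : (marg P M)%:E = P (cyl M).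
Proof. by rewrite /marg fineK// fin_num_measure//; exact: measurable_cyl. Qed.

Lemma marg_ge0 P n (M : {set n.-tuple A}) : 0 <= marg P M.
Proof. by rewrite -lee_fin EFin_marg. Qed.

Lemma marg_le1 P n (M : {set n.-tuple A}) : marg P M <= 1.
Proof. by rewrite -lee_fin EFin_marg probability_le1//; exact: measurable_cyl. Qed.

Lemma marg_setT P n : marg P [set: n.-tuple A] = 1.
Proof.
apply: EFin_inj; rewrite EFin_marg -(probability_setT P); congr (P _).
by apply/seteqP; split => x //= _; rewrite /cyl /= finset.in_setT.
Qed.

Lemma marg_sum P n (M : {set n.-tuple A}) :
  marg P M = \sum_(w in M) marg P [set w].
Proof.
apply: EFin_inj; rewrite EFin_marg -sumEFin.
under eq_bigr do rewrite EFin_marg.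
rewrite (_ : cyl M = \bigcup_(w in [set` M]) cyl [set w]); last first.
  apply/seteqP; split => x /=.
    by move=> xM; exists [tuple x (Posz (nat_of_ord i)) | i < n] => //; rewrite /cyl /= inE.
  by move=> [w /= wM]; rewrite /cyl /= inE => /eqP ->.
rewrite measure_fin_bigcup//.
- rewrite (_ : [set` M] = [set` enum M]); last first.
    by apply/seteqP; split => x /=; rewrite mem_enum.
  by rewrite -fsbig_seq ?enum_uniq// big_enum.
- move=> v w _ _ [x [] /=]; rewrite /cyl /= !inE => /eqP <- /eqP <- //.
- by move=> w _; exact: measurable_cyl.
Qed.

Lemma sum_marg P n : \sum_(w : n.-tuple A) marg P [set w] = 1.
Proof.
rewrite -(marg_setT P n) marg_sum; apply: eq_bigl => w; by rewrite finset.in_setT.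
Qed.

Lemma sum_marg_image P n m (f : n.-tuple A -> m.-tuple A) (F : m.-tuple A -> R) :
  (forall y, marg P [set x | f x == y] = marg P [set y]) ->
  \sum_x marg P [set x] * F (f x) = \sum_y marg P [set y] * F y.
Proof.
move=> fP; rewrite (partition_big f xpredT)//=.
apply: eq_bigr => y _; rewrite -fP marg_sum big_distrl /=.
under [RHS]eq_bigl do rewrite inE.
by apply: eq_bigr => x /eqP ->.
Qed.


(** [F] takes sequences, which avoids casts between tuple types. A prefix starts at coordinate 0
    already, whereas the suffix in the next lemma is moved back there by stationarity. *)
Lemma sum_marg_take P k n (F : seq A -> R) :
  \sum_(x : (k + n).-tuple A) marg P [set x] * F (take k x) =
  \sum_(y : k.-tuple A) marg P [set y] * F y.
Proof.
have sz (x : (k + n).-tuple A) : size (take k x) == k.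
  by rewrite size_takel// size_tuple leq_addr.
rewrite -(@sum_marg_image P _ _ (fun x => Tuple (sz x)) (fun y => F y))//.
move=> y; congr (fine (P _)); apply/seteqP.
have E (x : seqZ A) : take k [tuple x (Posz i) | i < k + n] =
    [tuple x (Posz i) | i < k].
  apply: (@eq_from_nth _ point).
    by rewrite size_takel ?size_tuple// leq_addr.
  move=> i; rewrite size_takel ?size_tuple ?leq_addr// => ik.
  rewrite nth_take//.
  have ikn : (i < k + n)%N by rewrite ltn_addr.
  by rewrite -(tnth_nth _ _ (Ordinal ikn)) -(tnth_nth _ _ (Ordinal ik)) !tnth_mktuple.
by split => x; rewrite /cyl /= !inE -!val_eqE /= E.
Qed.

Lemma sum_marg_drop P k n (F : seq A -> R) : stationary P ->
  \sum_(x : (k + n).-tuple A) marg P [set x] * F (drop k x) =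
  \sum_(y : n.-tuple A) marg P [set y] * F y.
Proof.
move=> sP.
have sz (x : (k + n).-tuple A) : size (drop k x) == n.
  by rewrite size_drop size_tuple addKn.
rewrite -(@sum_marg_image P _ _ (fun x => Tuple (sz x)) (fun y => F y))//.
move=> y; rewrite {2}/marg -(stationary_shifted_cyl _ k)//.
congr (fine (P _)); apply/seteqP.
have E (x : seqZ A) : drop k [tuple x (Posz i) | i < k + n] =
    [tuple x (Posz (k + i)) | i < n].
  apply: (@eq_from_nth _ point).
    by rewrite size_drop !size_tuple addKn.
  move=> i; rewrite size_drop size_tuple addKn => ik.
  rewrite nth_drop.
  have ikn : (k + i < k + n)%N by rewrite ltn_add2l.
  by rewrite -(tnth_nth _ _ (Ordinal ikn)) -(tnth_nth _ _ (Ordinal ik)) !tnth_mktuple.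
by split => x; rewrite /cyl /shifted_cyl /= !inE -!val_eqE /= E.
Qed.

End Marginals.

(** * Block laws and a universal law *)

Lemma ln_le_sub1 (R : realType) (x : R) : 0 < x -> ln x <= x - 1.
Proof.
by move=> x0; rewrite -[X in ln X](subrKC 1 x) le_ln1Dx// ltrBrDr addrC subrr.
Qed.

(** The counts are [1 + floor(N p t)]. The added one keeps every weight positive and raises the
    total to at most [N + #|T|], so [p t] exceeds its approximation by a factor of at most
    [1 + #|T| / N]. *)
Lemma rational_weights (R : realType) (T : finType) (p : T -> R) (e : R) :
  (forall t, 0 <= p t) -> \sum_t p t = 1 -> 0 < e ->
  exists f : {ffun T -> nat},
    - \sum_t p t * ln ((f t).+1%:R / (\sum_u (f u).+1)%:R) <=
    - (\sum_t p t * ln (p t)) + e.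
Proof.
move=> p0 p1 e0.
(* Chosen so that the final loss [#|T| / N] is at most [e]. *)
pose N := (Num.trunc (#|T|%:R / e)).+1.
have N0 : 0 < N%:R :> R by rewrite ltr0n.
have TN : #|T|%:R / N%:R <= e.
  rewrite ler_pdivrMr// mulrC -ler_pdivrMr//; apply: ltW; exact: truncnS_gt.
exists [ffun t => Num.trunc (N%:R * p t)].
set S := (\sum_u _)%N.
have SN : S%:R <= N%:R + #|T|%:R :> R.
  rewrite /S; under eq_bigr do rewrite ffunE -addn1.
  rewrite big_split /= sum1_card natrD lerD2r natr_sum.
  apply: (le_trans (y := \sum_t N%:R * p t)); last by rewrite -mulr_sumr p1 mulr1.
  apply: ler_sum => t _.
  by case/andP: (truncn_itv (mulr_ge0 (ltW N0) (p0 t))).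
have T0 : (0 < #|T|)%N.
  rewrite lt0n; apply: contra_eqN p1 => /eqP T0.
  by rewrite big1 ?(eq_sym 0) ?oner_eq0// => t; have := fintype0 t T0.
have S0 : 0 < S%:R :> R.
  rewrite ltr0n /S; have /card_gt0P[t _] := T0.
  by rewrite (bigD1 t)//= ltn_addr.
rewrite -lerBlDl opprK addrC -sumrB.
apply: (le_trans (y := \sum_t p t * (#|T|%:R / N%:R))); last first.
  by rewrite -mulr_suml p1 mul1r.
apply: ler_sum => t _; rewrite -mulrBr.
have := p0 t; rewrite le_eqVlt => /orP[/eqP <-|pt]; first by rewrite !mul0r.
rewrite ler_wpM2l// ffunE.
have v0 : 0 < (Num.trunc (N%:R * p t)).+1%:R / S%:R :> R.
  by rewrite divr_gt0// ltr0n.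
rewrite -ln_div//; apply: le_trans (ln_le_sub1 _ _ _) _; first exact: divr_gt0.
rewrite invf_div.
have h1 : N%:R * p t <= (Num.trunc (N%:R * p t)).+1%:R by rewrite ltW// truncnS_gt.
have f0 : 0 < (Num.trunc (N%:R * p t)).+1%:R :> R by rewrite ltr0n.
apply: (le_trans (y := (N%:R + #|T|%:R)/N%:R - 1)); last first.
  by rewrite mulrDl divff ?gt_eqF//; lra.
rewrite lerB// mulrA ler_pdivrMr// mulrAC ler_pdivlMr//.
have -> : p t * S%:R * N%:R = S%:R * (N%:R * p t) by ring.
by apply: ler_pM => //; rewrite ?ler0n// mulr_ge0// ltW.
Qed.

(** * Product laws on blocks *)

Section Tuples.
Context {R : realType} {A : pfinType}.
Implicit Types (v : seq A -> R).

Lemma sum_tuple_split k n (F G : seq A -> R) :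
  \sum_(x : (k + n).-tuple A) F (take k x) * G (drop k x) =
  (\sum_(y : k.-tuple A) F y) * (\sum_(z : n.-tuple A) G z).
Proof.
rewrite big_distrlr /= pair_big /=.
have szt (x : (k + n).-tuple A) : size (take k x) == k.
  by rewrite size_takel// size_tuple leq_addr.
have szd (x : (k + n).-tuple A) : size (drop k x) == n.
  by rewrite size_drop size_tuple addKn.
rewrite (reindex (fun p : k.-tuple A * n.-tuple A => [tuple of p.1 ++ p.2])) /=.
  apply: eq_bigr => -[y z] _ /=.
  by rewrite take_size_cat ?size_tuple// drop_size_cat ?size_tuple.
exists (fun x => (Tuple (szt x), Tuple (szd x))) => [[y z] _|x _] /=.
  congr pair; apply: val_inj => /=.
    by rewrite take_size_cat ?size_tuple.
  by rewrite drop_size_cat ?size_tuple.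
by apply: val_inj => /=; rewrite cat_take_drop.
Qed.

Lemma cardA_gt0 : 0 < #|A|%:R :> R.
Proof. by rewrite ltr0n; apply/card_gt0P; exists point. Qed.

Lemma cardA_ge1 : 1 <= #|A|%:R :> R.
Proof. by rewrite ler1n; apply/card_gt0P; exists point. Qed.

(* [m] independent blocks of length [k] with law [v], followed by independent uniform letters. *)
Fixpoint block_law k (v : seq A -> R) m (s : seq A) : R :=
  if m is m'.+1 then v (take k s) * block_law k v m' (drop k s)
  else #|A|%:R ^- size s.

Lemma block_law_gt0 k v m (s : seq A) :
  (forall t : k.-tuple A, 0 < v t) -> (m * k <= size s)%N -> 0 < block_law k v m s.
Proof.
move=> v0; elim: m s => [|m IH] s /=; first by rewrite invr_gt0 exprn_gt0// cardA_gt0.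
rewrite mulSn => ks; rewrite mulr_gt0//.
  have sz : size (take k s) == k by rewrite size_takel// (leq_trans _ ks)// leq_addr.
  exact: (v0 (Tuple sz)).
by apply: IH; rewrite size_drop leq_subRL// (leq_trans _ ks)// leq_addr.
Qed.

Lemma sum_block_law k v m r :
  \sum_(t : k.-tuple A) v t = 1 ->
  \sum_(x : (m * k + r).-tuple A) block_law k v m x = 1.
Proof.
move=> v1; elim: m => [|m IH] /=.
  rewrite mul0n add0n; under eq_bigr do rewrite size_tuple.
  rewrite big_const iter_addr_0 card_tuple.
  rewrite -[LHS]mulr_natl natrX divff//.
  by rewrite expf_neq0// gt_eqF// cardA_gt0.
rewrite mulSn -addnA (sum_tuple_split k (m * k + r) v (block_law k v m)).
by rewrite v1 IH mulr1.
Qed.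

(** The blocks need not be independent under [W]: the logarithm turns the product into a sum, whose
    terms have equal expectations by stationarity. Each of the [r] leftover letters adds
    [- ln #|A|]. *)
Lemma cross_entropy_block_law (W : process R A) k v m r : stationary W ->
  (forall t : k.-tuple A, 0 < v t) ->
  \sum_(x : (m * k + r).-tuple A) marg W [set x] * ln (block_law k v m x) =
  m%:R * (\sum_(t : k.-tuple A) marg W [set t] * ln (v t)) - r%:R * ln #|A|%:R.
Proof.
move=> sW v0; elim: m => [|m IH] /=.
  rewrite mul0r sub0r mul0n add0n.
  under eq_bigr do rewrite size_tuple lnV ?posrE ?exprn_gt0 ?cardA_gt0//
    lnXn ?cardA_gt0//.
  by rewrite -mulr_suml sum_marg mul1r mulr_natl.
rewrite mulSn -addnA.
under eq_bigr => x _.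
  rewrite lnM ?posrE; first last.
  - by apply: block_law_gt0 => //; rewrite size_drop size_tuple addKn leq_addr.
  - have sz : size (take k x) == k by rewrite size_takel// size_tuple leq_addr.
    exact: (v0 (Tuple sz)).
  rewrite mulrDr; over.
rewrite big_split /= (sum_marg_take _ _ _ (fun s => ln (v s))).
rewrite (sum_marg_drop _ _ _ (fun s => ln (block_law k v m s)))// IH.
by rewrite -natr1; ring.
Qed.

End Tuples.

(** * The universal mixture and its redundancy *)

Section UniversalLaw.
Context {R : realType} {A : pfinType}.
Implicit Types (W : process R A).

(** [block_law] expects a function on sequences, hence the value 0 off length [k]. The successors
    give full support, which keeps cross entropies finite. *)
Definition count_weight k (f : {ffun k.-tuple A -> nat}) (s : seq A) : R :=
  oapp (fun t => (f t).+1%:R / (\sum_u (f u).+1)%:R) 0 (insub s).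
Arguments count_weight {k}.

Lemma count_weightE k (f : {ffun k.-tuple A -> nat}) (t : k.-tuple A) :
  count_weight f t = (f t).+1%:R / (\sum_u (f u).+1)%:R.
Proof. by rewrite /count_weight valK. Qed.

Lemma count_weight_gt0 k (f : {ffun k.-tuple A -> nat}) (t : k.-tuple A) :
  0 < count_weight f t.
Proof.
by rewrite count_weightE divr_gt0 ?ltr0n// (bigD1 t)//= ltn_addr.
Qed.

Lemma sum_count_weight k (f : {ffun k.-tuple A -> nat}) :
  \sum_(t : k.-tuple A) count_weight f t = 1.
Proof.
under eq_bigr do rewrite count_weightE.
rewrite -mulr_suml -natr_sum divff// pnatr_eq0 -lt0n.
by rewrite (bigD1 [tuple point | i < k])//= ltn_addr.
Qed.

(* The [pickle] codes enumerate the pairs of a block length and rational weights, and the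
   normalised counts are dense among the laws on blocks. *)
Definition code_law (j : nat) (s : seq A) : R :=
  if (unpickle j : option {k : nat & {ffun k.+1.-tuple A -> nat}})
    is Some (existT k f)
  then block_law k.+1 (count_weight f) (size s %/ k.+1) s else 0.

Lemma code_law_ge0 j s : 0 <= code_law j s.
Proof.
rewrite /code_law; case: unpickle => // -[k f]; apply/ltW/block_law_gt0.
  exact: count_weight_gt0.
exact: leq_trunc_div.
Qed.

(** Only an inequality, because a [j] that codes nothing gives the zero law. *)
Lemma sum_code_law_le1 j n : \sum_(x : n.-tuple A) code_law j x <= 1.
Proof.
rewrite /code_law; case: unpickle => [[k f]|]; last by rewrite big1.
under eq_bigr do rewrite size_tuple.
have En := divn_eq n k.+1; set m := (n %/ _)%N in En *.
by rewrite En sum_block_law// sum_count_weight.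
Qed.

(* The sum stops at [size s] to stay finite; each component is present for large [size s], at
   a cost [j.+1 * ln 2] in code length that does not depend on [size s]. *)
Definition universal_law (s : seq A) : R :=
  \sum_(j < size s) 2 ^- j.+1 * code_law j s.

Lemma universal_law_ge0 s : 0 <= universal_law s.
Proof.
by apply: sumr_ge0 => j _; rewrite mulr_ge0 ?code_law_ge0// invr_ge0 exprn_ge0.
Qed.

Lemma sum_universal_law_le1 n : \sum_(x : n.-tuple A) universal_law x <= 1.
Proof.
under eq_bigr do rewrite /universal_law size_tuple.
rewrite exchange_big /=.
apply: (le_trans (y := \sum_(j < n) (2 : R) ^- j.+1)).
  apply: ler_sum => j _; rewrite -mulr_sumr -[leRHS]mulr1 ler_wpM2l//.
  exact: sum_code_law_le1.
suff -> : \sum_(j < n) (2 : R) ^- j.+1 = 1 - 2 ^- n.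
  by rewrite gerBl invr_ge0 exprn_ge0.
elim: n => [|n IH]; first by rewrite big_ord0 expr0 invr1 subrr.
rewrite big_ord_recr /= IH exprS invfM.
by set u := (2 ^- n : R); lra.
Qed.

Definition entropy W n : R :=
  - \sum_(w : n.-tuple A) marg W [set w] * ln (marg W [set w]).

Lemma entropy_ge0 W n : 0 <= entropy W n.
Proof.
rewrite oppr_ge0; apply: sumr_le0 => w _.
by rewrite mulr_ge0_le0 ?marg_ge0// ln_le0// marg_le1.
Qed.

(** As an infimum it bounds every normalised entropy below, and some single block length comes
    arbitrarily close to it. The index [n.+1] keeps the denominator positive. *)
Definition entropy_rate W : R := inf [set entropy W n.+1 / n.+1%:R | n in [set: nat]].

Lemma entropy_rate_has_inf W :
  has_inf [set entropy W n.+1 / n.+1%:R | n in [set: nat]].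
Proof.
split; first by exists (entropy W 1 / 1%:R), 0%N.
by exists 0 => _ [n _ <-]; rewrite divr_ge0// entropy_ge0.
Qed.

Lemma entropy_rate_le W n : n%:R * entropy_rate W <= entropy W n.
Proof.
case: n => [|n]; first by rewrite mul0r entropy_ge0.
rewrite mulrC -ler_pdivlMr//.
by apply: ge_inf; [exact: (entropy_rate_has_inf W).2|exists n].
Qed.

Lemma entropy_rate_ge0 W : 0 <= entropy_rate W.
Proof.
apply: lb_le_inf; first exact: (entropy_rate_has_inf W).1.
by move=> _ [n _ <-]; rewrite divr_ge0// entropy_ge0.
Qed.

(** The mixture is at least [2 ^- j.+1] times its component [j]. That component is built from a
    block length nearly attaining the entropy rate, with rational weights close to the block
    marginal of [W]. *)
Lemma universal_law_cross_entropy W e : stationary W -> 0 < e ->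
  exists j C, forall n, (j < n)%N ->
    (forall x : n.-tuple A, 0 < universal_law x) /\
    - (\sum_(x : n.-tuple A) marg W [set x] * ln (universal_law x)) <=
      n%:R * (entropy_rate W + e) + C.
Proof.
move=> sW e0.
(* Half of [e] pays for the distance to the infimum, the other half, per letter, for the rational
   weights. *)
have e20 : 0 < e / 2 by rewrite divr_gt0.
have [_ [k _ <-] hk] := inf_adherent e20 (entropy_rate_has_inf W).
rewrite -/(entropy_rate W) in hk.
have ek0 : 0 < k.+1%:R * (e / 2) by rewrite mulr_gt0.
have [f] := rational_weights _ _ _ _ (fun t : k.+1.-tuple A => marg_ge0 W _ [set t]%SET)
  (sum_marg W k.+1) ek0.
rewrite -/(entropy W k.+1) => hf.
pose c : {k : nat & {ffun k.+1.-tuple A -> nat}} := existT _ k f.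
(* The first term pays for the fewer than [k.+1] uniform leftover letters, the second for the
   mixture weight of component [j]. *)
pose j := pickle c; exists j, (k.+1%:R * ln #|A|%:R + j.+1%:R * ln 2).
move=> n jn.
have VE (x : n.-tuple A) : code_law j x =
    block_law k.+1 (count_weight f) (n %/ k.+1) x.
  by rewrite /code_law pickleK /= size_tuple.
have V0 (x : n.-tuple A) : 0 < code_law j x.
  rewrite VE; apply: block_law_gt0; first exact: count_weight_gt0.
  by rewrite size_tuple leq_trunc_div.
have UV (x : n.-tuple A) : 2 ^- j.+1 * code_law j x <= universal_law x.
  rewrite /universal_law size_tuple (bigD1 (Ordinal jn))//= lerDl.
  by apply: sumr_ge0 => i _; rewrite mulr_ge0 ?code_law_ge0// invr_ge0 exprn_ge0.
have V20 (x : n.-tuple A) : 0 < 2 ^- j.+1 * code_law j x.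
  by rewrite mulr_gt0// invr_gt0 exprn_gt0.
have U0 (x : n.-tuple A) : 0 < universal_law x by exact: lt_le_trans (UV x).
split => //.
have lnU (x : n.-tuple A) :
    - (marg W [set x] * ln (universal_law x)) <=
    marg W [set x] * (j.+1%:R * ln 2) - marg W [set x] * ln (code_law j x).
  rewrite -mulrBr -mulrN ler_wpM2l ?marg_ge0//.
  have : ln (2 ^- j.+1 * code_law j x) <= ln (universal_law x) by rewrite ler_ln ?posrE.
  rewrite lnM ?posrE ?invr_gt0 ?exprn_gt0// lnV ?posrE ?exprn_gt0// lnXn// -mulr_natl.
  lra.
rewrite -sumrN; apply: le_trans (ler_sum _ (fun x _ => lnU x)) _.
rewrite big_split /= -mulr_suml sum_marg mul1r sumrN.
under eq_bigr do rewrite VE.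
have En := divn_eq n k.+1; set m := (n %/ _)%N in En *; set r := (n %% _)%N in En *.
have -> : \sum_(x : n.-tuple A) marg W [set x] * ln (block_law k.+1 (count_weight f) m x)
    = m%:R * (\sum_(t : k.+1.-tuple A) marg W [set t] * ln (count_weight f t))
      - r%:R * ln #|A|%:R.
  rewrite [in LHS]En; apply: cross_entropy_block_law => // t.
  exact: count_weight_gt0.
under eq_bigr do rewrite count_weightE.
set CE := (\sum_t _) in hf *.
have CEle : - CE <= k.+1%:R * (entropy_rate W + e).
  apply: le_trans hf _.
  move: hk; rewrite ltr_pdivrMr// => /ltW hk; apply: le_trans (lerD hk (lexx _)) _.
  by rewrite le_eqVlt; apply/orP; left; apply/eqP; field.
have A0 : 0 <= ln #|A|%:R :> R by rewrite ln_ge0// cardA_ge1.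
have rk : r%:R * ln #|A|%:R <= k.+1%:R * ln #|A|%:R :> R.
  by rewrite ler_wpM2r// ler_nat ltnW// ltn_mod.
have mCE : m%:R * - CE <= n%:R * (entropy_rate W + e).
  apply: le_trans (ler_wpM2l (ler0n _ m) CEle) _.
  rewrite mulrA -natrM ler_wpM2r//; first by rewrite addr_ge0 ?entropy_rate_ge0// ltW.
  by rewrite ler_nat leq_trunc_div.
by rewrite mulrN in mCE; lra.
Qed.

(** The divergence of [W] from the mixture is at most [n * e + C], as the entropy rate cancels. A
    bad set of mass [s] forces it to be at least [n * d * s - 1], so [s] tends to 0. *)
Lemma universal_law_dominates W (d : R) : stationary W -> 0 < d ->
  (fun n => marg W [set x : n.-tuple A |
     expR (n%:R * d) * universal_law x < marg W [set x]%SET]%SET) @ \oo --> 0.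
Proof.
move=> sW d0; apply/cvgrPdist_le => /= eps eps0.
(* Half of the allowance [n * d * eps] goes to the linear redundancy; for large [n] the other half
   absorbs [1 + C]. *)
have e0 : 0 < d * (eps / 2) by rewrite mulr_gt0// divr_gt0.
have [j [C jC]] := universal_law_cross_entropy _ _ sW e0.
near=> n.
have jn : (j < n)%N by near: n; exact: nbhs_infty_gt.
have [U0 hU] := jC n jn.
rewrite sub0r normrN ger0_norm ?marg_ge0//.
set S := [set _ | _]%SET.
have n0 : 0 < n%:R :> R by rewrite ltr0n (leq_ltn_trans _ jn).
(* On [S] the log-ratio exceeds [n * d]. Off [S], [ln y <= y - 1] bounds the divergence term below
   by minus the mixture mass, which sums to at most 1. *)
have pt (x : n.-tuple A) :
    n%:R * d * (if x \in S then marg W [set x] else 0) - universal_law x <=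
    marg W [set x] * ln (marg W [set x]) - marg W [set x] * ln (universal_law x).
  have := marg_ge0 W _ [set x]%SET; rewrite le_eqVlt => /orP[/eqP <-|p0].
    by rewrite if_same mulr0 !mul0r subrr sub0r oppr_le0 universal_law_ge0.
  rewrite -mulrBr -ln_div ?posrE//; case: ifPn => xS.
    apply: (le_trans (y := n%:R * d * marg W [set x]%SET)).
      by rewrite gerBl universal_law_ge0.
    rewrite mulrC ler_wpM2l ?marg_ge0// -[leLHS]expRK ler_ln ?posrE ?expR_gt0 ?divr_gt0//.
    by rewrite ler_pdivlMr//; move: xS; rewrite inE => /ltW.
  rewrite mulr0 sub0r -[X in ln X]invf_div lnV ?posrE ?divr_gt0// mulrN lerN2.
  apply: (le_trans (y := marg W [set x]%SET * (universal_law x / marg W [set x]%SET - 1))).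
    by rewrite ler_wpM2l ?marg_ge0// ln_le_sub1 ?divr_gt0.
  by rewrite mulrBr mulr1 mulrCA divff ?gt_eqF// mulr1 gerBl marg_ge0.
have : \sum_(x : n.-tuple A) (n%:R * d * (if x \in S then marg W [set x]%SET else 0)
      - universal_law x) <=
    \sum_(x : n.-tuple A) (marg W [set x]%SET * ln (marg W [set x]%SET)
      - marg W [set x]%SET * ln (universal_law x)).
  by apply: ler_sum => x _; exact: pt.
rewrite [X in X <= _]sumrB [X in _ <= X]sumrB -mulr_sumr -big_mkcond /=.
rewrite -marg_sum => hS.
have S1 := sum_universal_law_le1 n.
have En := entropy_rate_le W n; rewrite /entropy in En.
have hn : 2 * (1 + C) <= n%:R * (d * eps).
  rewrite -ler_pdivrMr ?mulr_gt0//.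
  by near: n; exact: nbhs_infty_ger.
have : n%:R * d * marg W S <= n%:R * d * eps by lra.
by rewrite ler_pM2l// mulr_gt0.
Unshelve. all: by end_near.
Qed.

End UniversalLaw.

(** * Tests and divergence bounds *)

Lemma ereal_between (R : realType) (x y : \bar R) : (x < y)%E ->
  exists r : R, (x < r%:E)%E /\ (r%:E < y)%E.
Proof.
case: x y => [x| |] [y| |] //.
- rewrite lte_fin => xy; exists ((x + y) / 2).
  by rewrite !lte_fin midf_lt// midf_lt.
- by move=> _; exists (x + 1); rewrite lte_fin ltrDl ltr01 ltry.
- by move=> _; exists (y - 1); rewrite lte_fin gtrBl ltr01 ltNyr.
- by move=> _; exists 0; rewrite ltry ltNyr.
Qed.

(** * Upper and lower limits, and logarithms with value [-oo] at 0 *)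

Section LimSup.
Context {R : realType}.
Implicit Types (u : (\bar R)^nat) (a : \bar R).

Lemma limn_esup_lt u a : (limn_esup u < a)%E -> \forall n \near \oo, (u n < a)%E.
Proof.
rewrite /limn_esup limf_esupE => /ereal_inf_lt[_ [V Voo <-] Va].
apply: filterS Voo => n Vn; apply: le_lt_trans Va.
by apply: ereal_sup_ubound; exists n.
Qed.

Lemma limn_esup_le u a : (\forall n \near \oo, (u n <= a)%E) -> (limn_esup u <= a)%E.
Proof.
move=> ua; rewrite /limn_esup limf_esupE.
apply: ge_ereal_inf; exists (ereal_sup (u @` [set n | (u n <= a)%E])).
  by exists [set n | (u n <= a)%E].
by apply: ge_ereal_sup => _ [n un <-].
Qed.

Lemma limn_einf_ge u a : (\forall n \near \oo, (a <= u n)%E) -> (a <= limn_einf u)%E.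
Proof.
move=> au; rewrite /limn_einf leeNr; apply: limn_esup_le.
by apply: filterS au => n; rewrite leeN2.
Qed.

Lemma limn_einf_lt u a : (limn_einf u < a)%E ->
  forall N, exists2 n, (N <= n)%N & (u n < a)%E.
Proof.
move=> ua N; apply: contrapT => H; move: ua; apply/negP; rewrite -leNgt.
apply: limn_einf_ge; exists N => // n /= Nn; rewrite leNgt; apply/negP => una.
by apply: H; exists n.
Qed.

Lemma elog_le (q r : R) : 0 <= q -> q <= expR r -> (elog q <= r%:E)%E.
Proof.
rewrite /elog; case: eqVneq => [_ _ _|q0 q1 qr]; first by rewrite leNye.
by rewrite lee_fin -[r]expRK ler_ln ?posrE ?expR_gt0// lt_neqAle eq_sym q0.
Qed.

Lemma elog_lt (q r : R) : 0 <= q -> (elog q < r%:E)%E -> q < expR r.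
Proof.
rewrite /elog; case: eqVneq => [-> _ _|q0 q1]; first exact: expR_gt0.
by rewrite lte_fin -[X in _ < X]expRK ltr_ln ?posrE ?expR_gt0// lt_neqAle eq_sym q0.
Qed.

End LimSup.

(** * Likelihood-ratio tests and the variational bound on divergence *)

Section Tests.
Context {R : realType} {A : pfinType}.
Implicit Types (P W Q : process R A).

(** A Neyman-Pearson test of [Q] against the universal law; a family of sources enters only through
    the threshold [c]. *)
Definition test_set Q (c : R) n : {set n.-tuple A} :=
  [set x : n.-tuple A |
    marg Q [set x]%SET <= expR (- (n%:R * c)) * universal_law x]%SET.

Lemma marg_test_set Q c n : marg Q (test_set Q c n) <= expR (- (n%:R * c)).
Proof.
rewrite marg_sum; apply: (le_trans (y := \sum_(x in test_set Q c n)
    expR (- (n%:R * c)) * universal_law x)).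
  by apply: ler_sum => x; rewrite inE.
rewrite -mulr_sumr -[leRHS]mulr1 ler_wpM2l ?expR_ge0//.
apply: le_trans (sum_universal_law_le1 (A := A) n).
rewrite [leRHS](bigID (fun x => x \in test_set Q c n))/= lerDl sumr_ge0// => x _.
exact: universal_law_ge0.
Qed.

Lemma limn_esup_test_set Q c : (limn_esup (lograte Q (test_set Q c)) <= (- c)%:E)%E.
Proof.
apply: limn_esup_le; exists 1%N => // n /= n1.
rewrite /lograte lee_pdivrMr ?ltr0n// -EFinM; apply: elog_le; first exact: marg_ge0.
by rewrite mulNr mulrC marg_test_set.
Qed.

(** A word of [M] outside both the test and the exceptional set [S] satisfies [W(x) <= K * Q(x)]
    with [K = expR (n * (c + d))]. Such words have [W]-mass at most [K * Q(M)], which vanishes as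
    [Q(M)] decays at the faster rate [c']. *)
Lemma test_set_typical W Q c (l : \bar R) : stationary W -> (c%:E < l)%E ->
  (forall eps : R, 0 < eps < 1 -> (betabar eps W Q <= - l)%E) ->
  (fun n => marg W (test_set Q c n)) @ \oo --> (1 : R).
Proof.
move=> sW /ereal_between[c' []]; rewrite lte_fin => cc' c'l hb.
apply/cvgrPdist_le => /= e e0.
(* The error [e] is shared by the complement of [M], the set [S] and the term [K * Q(M)]; the cap
   [1 / 2] keeps [eps] below 1. *)
pose eps := Num.min (e / 3) (1 / 2).
have eps01 : 0 < eps < 1.
  by rewrite lt_min gt_min divr_gt0//=; apply/andP; split; [lra|apply/orP; right; lra].
have epse : eps <= e / 3 by rewrite ge_min lexx.
(* Half the gap, so that [c + d - c' = - d] and [K * Q(M) <= expR (- (n * d))]. *)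
pose d := (c' - c) / 2.
have d0 : 0 < d by rewrite /d; lra.
have e30 : 0 < e / 3 by rewrite divr_gt0.
have nb : (betabar eps W Q < (- c')%:E)%E.
  by apply: le_lt_trans (hb _ eps01) _; rewrite EFinN lteN2.
have nS : \forall n \near \oo, marg W [set x : n.-tuple A |
    expR (n%:R * d) * universal_law x < marg W [set x]%SET]%SET <= e / 3.
  have /cvgrPdist_le/(_ _ e30) := universal_law_dominates W d sW d0.
  by apply: filterS => n /=; rewrite sub0r normrN ger0_norm ?marg_ge0.
near=> n.
have n0 : 0 < n%:R :> R.
  by rewrite ltr0n; near: n; exact: nbhs_infty_gt.
have : (beta eps n W Q * (n%:R^-1)%:E < (- c')%:E)%E.
  by near: n; exact: limn_esup_lt.
rewrite lte_pdivrMr// -EFinM => /ereal_inf_lt[_ [M /= WM <-]].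
move=> /(elog_lt _ _ (marg_ge0 _ _ _)) /ltW QM.
set S := [set x : n.-tuple A |
     expR (n%:R * d) * universal_law x < marg W [set x]%SET]%SET.
have WS : marg W S <= e / 3.
  by rewrite /S; near: n.
have En : expR (- (n%:R * d)) <= e / 3.
  have h : expR (- ln (e / 3)) = (e / 3)^-1 by rewrite expRN lnK// posrE.
  rewrite -[leRHS]lnK ?posrE// ler_expR lerNl -ler_pdivrMr//.
  by near: n; exact: nbhs_infty_ger.
set K := expR (n%:R * (c + d)).
have pt (x : n.-tuple A) : (if x \in M then marg W [set x]%SET else 0) <=
    (if x \in test_set Q c n then marg W [set x]%SET else 0) +
    (if x \in S then marg W [set x]%SET else 0) +
    K * (if x \in M then marg Q [set x]%SET else 0).
  have W0 := marg_ge0 W _ [set x]%SET.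
  have KQ0 : 0 <= K * marg Q [set x]%SET by rewrite mulr_ge0 ?marg_ge0// expR_ge0.
  case: (x \in M); last by rewrite mulr0 addr0 addr_ge0//; case: ifP.
  case: ifPn => [_|]; first by rewrite -addrA lerDl addr_ge0//; case: ifP.
  rewrite inE -ltNge => xT.
  case: ifPn => [_|]; first by rewrite add0r lerDl.
  rewrite inE -leNgt => xS; rewrite !add0r.
  apply: le_trans xS _; rewrite /K mulrDr expRD [expR (n%:R * c) * _]mulrC -mulrA.
  rewrite ler_wpM2l ?expR_ge0//.
  by rewrite -ler_pdivrMl ?expR_gt0// -expRN ltW.
have : \sum_(x : n.-tuple A) (if x \in M then marg W [set x]%SET else 0) <=
    \sum_(x : n.-tuple A) ((if x \in test_set Q c n then marg W [set x]%SET else 0) +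
    (if x \in S then marg W [set x]%SET else 0) +
    K * (if x \in M then marg Q [set x]%SET else 0)).
  by apply: ler_sum => x _; exact: pt.
rewrite [X in _ <= X]big_split [X in _ <= X + _]big_split -mulr_sumr.
rewrite -!big_mkcond -!marg_sum /= => h.
have KQ : K * marg Q M <= e / 3.
  apply: le_trans En; apply: le_trans (ler_wpM2l (expR_ge0 _) QM) _.
  rewrite /K -expRD ler_expR le_eqVlt; apply/orP; left; apply/eqP.
  by rewrite /d; field.
rewrite ger0_norm ?subr_ge0 ?marg_le1//; lra.
Unshelve. all: by end_near.
Qed.

(** Sum the Young inequality [p * ln (p / q) >= p * s + p - q * expR s] over all words, with [s = a]
    on [M] and [s = 0] elsewhere. *)
Lemma kl_ge W Q n (M : {set n.-tuple A}) (a : R) :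
  ((a * marg W M + marg Q M - marg Q M * expR a)%:E <= kl W Q n)%E.
Proof.
pose t (x : n.-tuple A) := if x \in M then a else 0.
have pt (p q s : R) : 0 <= p -> 0 <= q ->
    ((p * s + p - q * expR s)%:E <= kl_term p q)%E.
  rewrite /kl_term le_eqVlt eq_sym; case: eqVneq => [->|p0]/=.
    by move=> _ q0; rewrite mul0r add0r sub0r lee_fin oppr_le0 mulr_ge0// expR_ge0.
  move=> {}p0; case: eqVneq => [|q0]; first by rewrite leey.
  rewrite le_eqVlt eq_sym (negbTE q0)/= => {}q0.
  rewrite lee_fin -[p / q]invf_div lnV ?posrE ?divr_gt0// mulrN.
  have : ln (q / p * expR s) <= q / p * expR s - 1.
    by rewrite ln_le_sub1// mulr_gt0 ?divr_gt0// expR_gt0.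
  rewrite lnM ?posrE ?divr_gt0 ?expR_gt0// expRK => /(ler_wpM2l (ltW p0)).
  rewrite [X in _ <= X]mulrBr mulr1 mulrDr.
  have -> : p * (q / p * expR s) = q * expR s by field; rewrite gt_eqF.
  lra.
rewrite /kl; apply: (@le_trans _ _ (\sum_(x : n.-tuple A)
   (marg W [set x]%SET * t x + marg W [set x]%SET - marg Q [set x]%SET * expR (t x))%:E)%E);
  last by apply: lee_sum => x _; apply: pt; exact: marg_ge0.
rewrite sumEFin lee_fin sumrB big_split /= sum_marg.
have -> : \sum_(x : n.-tuple A) marg W [set x]%SET * t x = a * marg W M.
  rewrite marg_sum mulr_sumr [RHS]big_mkcond; apply: eq_bigr => x _.
  by rewrite /t; case: ifP; rewrite ?mulr0// mulrC.
have -> : \sum_(x : n.-tuple A) marg Q [set x]%SET * expR (t x) =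
    1 + marg Q M * (expR a - 1).
  rewrite -(sum_marg Q n) (marg_sum _ _ M) mulr_suml [X in _ + X]big_mkcond -big_split.
  apply: eq_bigr => x _; rewrite /t; case: ifP => _ /=; last by rewrite expR0 mulr1 addr0.
  by rewrite sum_marg; ring.
by rewrite le_eqVlt; apply/orP; left; apply/eqP; ring.
Qed.

Lemma kl_seq_ge0 W Q n : (0 <= kl_seq W Q n)%E.
Proof.
rewrite /kl_seq mule_ge0 ?lee_fin ?invr_ge0//.
by have := kl_ge W Q n finset.set0 0; rewrite expR0 mul0r add0r mulr1 subrr.
Qed.

Lemma rel_ent_rate_ge0 W Q : has_rel_ent_rate W Q -> (0 <= rel_ent_rate W Q)%E.
Proof.
move=> [l hl]; apply: lime_ge; first by apply/cvg_ex; exists l.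
by near=> n; exact: kl_seq_ge0.
Unshelve. all: by end_near.
Qed.

(** Since [kl_seq] converges, infinitely many good [n] suffice. There [kl_ge] with [a = c * n] gives
    a divergence of at least [c * n * W(M) - 1]. *)
Lemma rel_ent_rate_ge W Q (M : forall n, {set n.-tuple A}) (c : R) :
  has_rel_ent_rate W Q -> 0 < c ->
  (forall d : R, 0 < d -> forall N, exists n, [/\ (N <= n)%N,
     (lograte Q M n < (- c)%:E)%E & 1 - d < marg W (M n)]) ->
  (c%:E <= rel_ent_rate W Q)%E.
Proof.
move=> hW c0 hM; rewrite leNgt; apply/negP => /ereal_between[b [lb]].
rewrite lte_fin => bc.
have b0 : 0 < b by rewrite -lte_fin; apply: le_lt_trans lb; exact: rel_ent_rate_ge0.
have cv : kl_seq W Q @ \oo --> rel_ent_rate W Q.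
  by case: hW => l hl; rewrite /rel_ent_rate (cvg_lim _ hl).
have nb : \forall n \near \oo, (kl_seq W Q n < b%:E)%E.
  by apply: limn_esup_lt; rewrite (cvg_limn_einf_sup cv).2.
(* With this [d] the main term exceeds [n * (c + b) / 2], and [n >= 2 / (c - b)] absorbs the [- 1],
   contradicting the upper bound [n * b]. *)
have d0 : 0 < (c - b) / (2 * c) by rewrite divr_gt0 ?subr_gt0// mulr_gt0.
have ns : \forall n \near \oo, 2 / (c - b) <= n%:R by exact: nbhs_infty_ger.
have [N _ hN] : \forall n \near \oo, (kl_seq W Q n < b%:E)%E /\ 2 / (c - b) <= n%:R.
  by apply: filterS2 nb ns.
have [n [Nn Qn Wn]] := hM _ d0 N.
have [kn] := hN _ Nn; rewrite ler_pdivrMr ?subr_gt0// => nn.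
have n0 : 0 < n%:R :> R.
  rewrite ltr0n lt0n; apply/eqP => n0; move: nn; rewrite n0 mul0r.
  by rewrite leNgt ltr0n.
move: Qn; rewrite /lograte lte_pdivrMr// -EFinM => /(elog_lt _ _ (marg_ge0 _ _ _)).
rewrite mulNr expRN => /ltW Qn.
move: kn; rewrite /kl_seq lte_pdivrMr// => /(le_lt_trans (kl_ge W Q n (M n) (c * n%:R))).
rewrite -EFinM lte_fin.
have {}Qn : marg Q (M n) * expR (c * n%:R) <= 1.
  by rewrite -ler_pdivlMr ?expR_gt0// div1r.
have Q0 := marg_ge0 Q _ (M n).
have : c * n%:R * (1 - (c - b) / (2 * c)) <= c * n%:R * marg W (M n).
  by rewrite ler_wpM2l// ?ltW// mulr_gt0.
have -> : c * n%:R * (1 - (c - b) / (2 * c)) = n%:R * (c + b) / 2.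
  by field; rewrite gt_eqF.
lra.
Qed.

End Tests.

(** * Passing to the ergodic decomposition *)

Section Decomposition.
Context {R : realType} {A : pfinType}.
Implicit Types (P Q : process R A) (gam : probability (procspace R A) R).

(** The identity on laws is a probability kernel, and kernels have measurable evaluations. *)
Lemma measurable_eval (B : set (seqZ A)) : measurable B ->
  measurable_fun [set: procspace R A]
    (fun W : procspace R A => (W : process R A) B).
Proof.
exact: (measurable_kernel (kprobability (@measurable_id _ (procspace R A) setT))).
Qed.

Lemma integral_cst_prob gam (r : R) : (\int[gam]_W r%:E = r%:E)%E.
Proof.
by rewrite integral_cst// [X in (_ * X)%E](_ : _ = 1%E) ?mule1//; exact: probability_setT.
Qed.

Lemma decomposition_cvg1 P gam (M : forall n, {set n.-tuple A}) :
  ergodic_decomposition P gam ->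
  {ae gam, forall W : procspace R A, (fun n => marg W (M n)) @ \oo --> (1 : R)} ->
  (fun n => marg P (M n)) @ \oo --> (1 : R).
Proof.
move=> [_ Pint] WM.
pose f n (W : procspace R A) := (W : process R A) (cyl (M n)).
have mf n : measurable_fun setT (f n).
  by apply: measurable_eval; exact: measurable_cyl.
have f1 : {ae gam, forall W, setT W -> f ^~ W @ \oo --> 1%E}.
  apply: filterS WM => W WM _.
  rewrite (_ : f ^~ W = (fun n => (marg W (M n))%:E)); last first.
    by apply/funext => n; rewrite EFin_marg.
  by apply: cvg_EFin; [exact: nearW|exact: WM].
have i1 : gam.-integrable setT (EFin \o cst (1 : R)).
  exact: finite_measure_integrable_cst.
have f_le1 : {ae gam, forall W, forall n, setT W -> (`|f n W| <= (EFin \o cst (1%R : R)) W)%E}.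
  apply: aeW => W n _; rewrite gee0_abs//.
  exact: probability_le1 (measurable_cyl _ _).
have [_ _] := dominated_convergence measurableT mf (measurable_cst _) f1 i1 f_le1.
rewrite (integral_cst_prob gam) => h.
have {}h : (fun n => (marg P (M n))%:E) @ \oo --> 1%E.
  apply: cvg_trans h; apply: near_eq_cvg; apply: nearW => n /=.
  by rewrite EFin_marg Pint//; exact: measurable_cyl.
exact: (fine_cvg h).
Qed.

(** A threshold below the essential infimum lies below the rate of almost every component, where
    [test_set_typical] applies. *)
Lemma test_set_cvg1 P Q gam (c : R) :
  ergodic_decomposition P gam ->
  {ae gam, forall W : procspace R A, has_rel_ent_rate W Q /\
     forall eps : R, 0 < eps < 1 -> (betabar eps W Q <= - rel_ent_rate W Q)%E} ->
  (c%:E < ess_inf gam (fun W : procspace R A => rel_ent_rate W Q))%E ->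
  (fun n => marg P (test_set Q c n)) @ \oo --> (1 : R).
Proof.
move=> Pgam hb ch; apply: (decomposition_cvg1 P gam) => //.
have hle := ess_inf_le gam (fun W : procspace R A => rel_ent_rate W Q).
have F : Filter (nbhs (almost_everywhere gam)) by exact: ae_filter_ringOfSetsType.
apply: filterS (filterI Pgam.1 (filterI hb hle)) => W [[sW _] [[_ bW] hW]].
exact: (test_set_typical W Q c (rel_ent_rate W Q)) (lt_le_trans ch hW) bW.
Qed.

Lemma rate_ge_of_test P Q gam (M : forall n, {set n.-tuple A}) (c : R) :
  ergodic_decomposition P gam ->
  {ae gam, forall W : procspace R A, has_rel_ent_rate W Q} ->
  (fun n => marg P (M n)) @ \oo --> (1 : R) ->
  0 < c -> (limn_einf (lograte Q M) < (- c)%:E)%E ->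
  {ae gam, forall W : procspace R A, (c%:E <= rel_ent_rate W Q)%E}.
Proof.
move=> [_ Pint] hW PM c0 Qc.
(* The value 1 at bad [n] replaces the extraction of a subsequence: a small [f n W] certifies both
   that [n] is good and that [W] nearly fills [M n]. *)
pose f n (W : procspace R A) : \bar R :=
  if (lograte Q M n < (- c)%:E)%E then (W : process R A) (cyl (~: M n)%SET) else 1%E.
have mf n : measurable_fun setT (f n).
  rewrite /f; case: (lograte Q M n < (- c)%:E)%E; last exact: measurable_cst.
  by apply: measurable_eval; exact: measurable_cyl.
have f0 n W : (0 <= f n W)%E by rewrite /f; case: ifP.
have margC (V : process R A) n : marg V (~: M n)%SET = 1 - marg V (M n).
  apply/eqP; rewrite eq_sym subr_eq; apply/eqP.
  rewrite -(sum_marg V n) !marg_sum (bigID (fun x => x \in M n)) /= addrC.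
  by congr (_ + _); apply: eq_bigl => x; rewrite inE.
have intf n : (\int[gam]_W f n W = if (lograte Q M n < (- c)%:E)%E
    then (1 - marg P (M n))%:E else 1)%E.
  rewrite /f; case: (lograte Q M n < (- c)%:E)%E; last exact: integral_cst_prob.
  by rewrite -margC EFin_marg Pint//; exact: measurable_cyl.
(* Infinitely many [n] are good, and along them the integral is [1 - marg P (M n)], which tends to
   0. *)
have lim0 : (limn_einf (fun n => \int[gam]_W f n W) <= 0)%E.
  rewrite leNgt; apply/negP => /ereal_between[e []]; rewrite lte_fin => e0 he.
  have [N _ hN] : \forall n \near \oo, `|1 - marg P (M n)| <= e.
    by move/cvgrPdist_le: PM; apply.
  have : (e%:E < limn_einf (fun n => \int[gam]_W f n W))%E by [].
  rewrite /limn_einf lteNr => /limn_esup_lt[N' _ hN'].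
  have [n nN Qn] := limn_einf_lt _ _ Qc (maxn N N').
  move: nN; rewrite geq_max => /andP[nN nN'].
  have : (e%:E < \int[gam]_W f n W)%E by rewrite -lteN2; exact: hN'.
  rewrite intf Qn lte_fin ltNge => /negP; apply.
  by apply: le_trans (hN n nN); rewrite ler_norm.
have mg : measurable_fun setT (fun W => limn_einf (f ^~ W)).
  rewrite /limn_einf; apply: measurableT_comp => //.
  by apply: measurable_fun_limn_esup => n; exact: measurableT_comp.
have g0 W : (0 <= limn_einf (f ^~ W))%E.
  by apply: limn_einf_ge; apply: nearW => n; exact: f0.
have int0 : (\int[gam]_W `|limn_einf (f ^~ W)| = 0)%E.
  apply/eqP; rewrite eq_le integral_ge0// andbT.
  apply: le_trans lim0.
  under eq_integral do rewrite gee0_abs//.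
  by apply: fatou.
have ae0 := (ae_eq_integral_abs gam measurableT mg).1 int0.
apply: filterS2 hW ae0 => W hW /(_ I) /= W0.
apply: (rel_ent_rate_ge W Q M) => // d d0 N.
(* The bound by 1 excludes the bad [n]. *)
have : (limn_einf (f ^~ W) < (Num.min d 1)%:E)%E.
  by rewrite W0 lte_fin lt_min d0 ltr01.
move=> /limn_einf_lt/(_ N)[n Nn]; rewrite /f; case: ifP => [Qn|_]; last first.
  by rewrite lte_fin lt_min ltxx andbF.
rewrite -EFin_marg lte_fin lt_min margC => /andP[h _].
by exists n; split => //; lra.
Qed.

End Decomposition.

(** * Both exponents for a family of sources *)

Theorem mainTheorem6 (R : realType) (A : pfinType) (Q : process R A)
  (Theta : set (process R A))
  (gam : process R A -> probability (procspace R A) R) :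
  (forall P, Theta P -> stationary P) ->
  (forall P, Theta P -> ergodic_decomposition P (gam P)) ->
  (forall P, Theta P ->
     {ae gam P, forall W : procspace R A,
        has_rel_ent_rate W Q /\
        forall eps : R, 0 < eps < 1 -> (betabar eps W Q <= - rel_ent_rate W Q)%E}) ->
  (forall P, Theta P -> (0 <= hlow gam P Q)%E) /\
  (forall Om : set (process R A), Om `<=` Theta ->
     (forall eta : R, 0 < eta ->
        exists M : forall n, {set n.-tuple A},
          (forall P, Om P -> (fun n => marg P (M n)) @ \oo --> (1 : R)) /\
          (limn_esup (lograte Q M) <=
             (if (hlowset gam Om Q < +oo)%E
              then - hlowset gam Om Q + eta%:E
              else (- eta^-1)%:E))%E) /\
     (forall Mt : forall n, {set n.-tuple A},
        (forall P, Om P -> (fun n => marg P (Mt n)) @ \oo --> (1 : R)) ->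
        (- hlowset gam Om Q <= limn_einf (lograte Q Mt))%E)).
Proof.
move=> _ erg hyp.
have h0 P : Theta P -> (0 <= hlow gam P Q)%E.
  move=> TP; apply/ess_infP; apply: filterS (hyp P TP) => W [hW _].
  exact: rel_ent_rate_ge0.
split=> // Om OmT.
have hs0 : (0 <= hlowset gam Om Q)%E.
  by apply: le_ereal_inf_tmp => _ [P OP <-]; apply: h0; exact: OmT.
split=> [eta eta0|Mt Mt1].
  (* The threshold is [h - eta] for a finite infimum [h] and [eta^-1] for an infinite one. *)
  have [c [ch cle]] : exists c : R, (c%:E < hlowset gam Om Q)%E /\
      ((- c)%:E <= if (hlowset gam Om Q < +oo)%E
         then - hlowset gam Om Q + eta%:E else (- eta^-1)%:E)%E.
    case: (hlowset gam Om Q) hs0 => [h| |] // _; last by exists eta^-1; rewrite ltry.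
    exists (h - eta); rewrite ltry -EFinN -EFinD lte_fin lee_fin gtrBl eta0.
    by rewrite opprB addrC.
  exists (test_set Q c); split; last exact: le_trans (limn_esup_test_set Q c) cle.
  move=> P OP; have TP := OmT _ OP.
  apply: (test_set_cvg1 P Q (gam P)); [exact: erg|exact: hyp|].
  apply: lt_le_trans ch _.
  by apply: ereal_inf_lbound; exists P.
(* If the lower limit were below [b < - hlowset gam Om Q], some [P] in [Om] would have [hlow] below
   [- b > 0], although almost all its components have rate at least [- b]. *)
rewrite leNgt; apply/negP => /ereal_between[b [lb bh]].
have {bh} bh : (hlowset gam Om Q < (- b)%:E)%E by rewrite EFinN lteNr.
have [_ [P OP <-] hP] := ereal_inf_lt bh.
have b0 : 0 < - b by rewrite -lte_fin; exact: le_lt_trans hs0 bh.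
move: hP; apply/negP; rewrite -leNgt; apply/ess_infP.
have TP := OmT _ OP.
apply: (rate_ge_of_test P Q (gam P) Mt) => //.
- exact: erg.
- by apply: filterS (hyp P TP) => W [].
- exact: Mt1.
- by rewrite opprK.
Qed.
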